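(* For every positive integer $h$ and complex numbers $\alpha,\beta,\gamma,\delta,s$ (as an identity of meromorphic functions), $$h^{-s+\alpha}C_{\alpha,\beta,\gamma,\delta,h}(-s)=h^{s-\delta}C_{-\delta,-\gamma,-\beta,-\alpha,h}(s).$$
   Context: For a positive integer $h$ and complex $a,b,c,d,s$, with $p^{h_p}\|h$ ($p^{h_p}$ exactly divides $h$) and $x=p^{-a-d-2s}$, define $$C_{a,b,c,d,h}(s)=\prod_{p\mid h}(1-p^{-2+a-b+c-d})^{-1}\prod_{p^{h_p}\|h}\frac{C^{(0)}-p^{-1}C^{(1)}+p^{-2}C^{(2)}}{1-p^{-a-d-2s}},$$ where $C^{(0)}=1-x^{1+h_p}$, $C^{(1)}=(p^{c-d}+p^{a-b}x)(1-x^{h_p})$, $C^{(2)}=p^{a-b+c-d}(x-x^{h_p})$. *)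

(* Defs.v *)
From mathcomp Require Import all_boot all_order all_algebra.
From mathcomp Require Import complex.
From mathcomp Require Import reals sequences exp trigo.

Set Implicit Arguments.
Unset Strict Implicit.
Unset Printing Implicit Defensive.

Import Order.TTheory GRing.Theory Num.Theory.

Local Open Scope ring_scope.
Local Open Scope complex_scope.

Section Definitions.
Variable R : realType.
Implicit Types (a b c d s z : R[i]) (n h p : nat).

Definition cexp z : R[i] :=
  (expR (complex.Re z) * cos (complex.Im z)) +i*
  (expR (complex.Re z) * sin (complex.Im z)).

(* n ^ z = exp (z log n), with the real logarithm; meaningful for n > 0. *)
Definition natpow n z : R[i] := cexp (z * (ln n%:R)%:C).

Definition Cx a d s p : R[i] := natpow p (- a - d - 2 * s).

Definition C0 a d s p (hp : nat) : R[i] := 1 - Cx a d s p ^+ (1 + hp).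

Definition C1 a b c d s p (hp : nat) : R[i] :=
  (natpow p (c - d) + natpow p (a - b) * Cx a d s p) * (1 - Cx a d s p ^+ hp).

Definition C2 a b c d s p (hp : nat) : R[i] :=
  natpow p (a - b + c - d) * (Cx a d s p - Cx a d s p ^+ hp).

Definition C a b c d h s : R[i] :=
  (\prod_(p <- primes h) (1 - natpow p (- 2 + a - b + c - d))^-1) *
  \prod_(p <- primes h)
    ((C0 a d s p (logn p h)
      - p%:R ^- 1 * C1 a b c d s p (logn p h)
      + p%:R ^- 2 * C2 a b c d s p (logn p h))
     / (1 - natpow p (- a - d - 2 * s))).

(* No denominator in the formula for C vanishes.  Off this set of parameters
   the value of C is an artefact of the convention 0^-1 = 0. *)
Definition C_defined a b c d h s : Prop :=
  forall p, prime p -> (p %| h)%N ->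
    1 - natpow p (- 2 + a - b + c - d) != 0 /\
    1 - natpow p (- a - d - 2 * s) != 0.

End Definitions.

(* Main.v *)
Require Import Defs.
From mathcomp Require Import all_boot all_order all_algebra.
From mathcomp Require Import complex.
From mathcomp Require Import reals.
From mathcomp Require Import sequences exp trigo ring.

Import GRing.Theory Num.Theory.
Local Open Scope ring_scope.
Local Open Scope complex_scope.

(** Both sides are products over the primes dividing [h]. With
    [x = p ^ (2 s - alpha - delta)], the right-hand parameters replace [x] by
    [x^-1] and exchange [u = p ^ (gamma - delta)] and [v = p ^ (alpha - beta)],
    while the ratio of the two powers of [h] contributes [x ^- h_p]. Each of
    [C0], [C1], [C2] over [1 - x] is invariant under this substitution. *)

Section NatPow.
Variable R : realType.
Implicit Types (z w : R[i]) (m n h : nat).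

Lemma cexpD z w : cexp (z + w) = cexp z * cexp w.
Proof.
case: z w => [a b] [c d]; rewrite /cexp /= expRD cosD sinD.
by apply/eqP; rewrite eq_complex /=; apply/andP; split; apply/eqP; ring.
Qed.

Lemma cexp0 : cexp (0 : R[i]) = 1.
Proof. by rewrite /cexp /= expR0 cos0 sin0 mulr1 mulr0. Qed.

Lemma natpowD n z w : natpow n (z + w) = natpow n z * natpow n w.
Proof. by rewrite /natpow mulrDl cexpD. Qed.

Lemma natpow0 n : natpow n (0 : R[i]) = 1.
Proof. by rewrite /natpow mul0r cexp0. Qed.

Lemma natpow1n z : natpow 1 z = 1.
Proof. by rewrite /natpow ln1 mulr0 cexp0. Qed.

Lemma natpow_mulN n z : natpow n z * natpow n (- z) = 1.
Proof. by rewrite -natpowD subrr natpow0. Qed.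

Lemma natpow_neq0 n z : natpow n z != 0.
Proof.
by apply: contra_eq_neq (natpow_mulN n z) => ->; rewrite mul0r eq_sym oner_neq0.
Qed.

Lemma natpowN n z : natpow n (- z) = (natpow n z)^-1.
Proof. by apply: (mulfI (natpow_neq0 n z)); rewrite natpow_mulN divff ?natpow_neq0. Qed.

Lemma natpowMn m n z : (0 < m)%N -> (0 < n)%N ->
  natpow (m * n) z = natpow m z * natpow n z.
Proof.
move=> m0 n0; rewrite /natpow natrM lnM ?posrE ?ltr0n//.
by rewrite rmorphD mulrDr cexpD.
Qed.

Lemma natpowXn n k z : (0 < n)%N -> natpow (n ^ k) z = natpow n z ^+ k.
Proof.
move=> n0; elim: k => [|k IHk]; first by rewrite natpow1n.
by rewrite expnS exprS natpowMn ?expn_gt0 ?n0// IHk.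
Qed.

(** Lets the powers of [h] outside [C] be absorbed, prime by prime, into its product over
    [primes h]. *)
Lemma natpow_primes h z : (0 < h)%N ->
  natpow h z = \prod_(p <- primes h) natpow p z ^+ logn p h.
Proof.
move=> h0; rewrite {1}(prod_prime_decomp h0) prime_decompE big_map /=.
have: all (ltn 0) (primes h).
  by apply/allP => p; rewrite mem_primes => /andP[/prime_gt0].
elim: (primes h) => [|p s IHs] /=; first by rewrite !big_nil natpow1n.
case/andP=> p0 s0; rewrite !big_cons natpowMn ?natpowXn ?IHs// ?expn_gt0 ?p0//.
(* Side condition of [natpowMn]: the product over the remaining primes is positive. *)
by elim: s s0 {IHs} => [|q s IHs] /=; rewrite ?big_nil// big_cons muln_gt0 expn_gt0
  => /andP[-> /IHs].
Qed.

End NatPow.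

Lemma C_local_factor_invert (F : fieldType) (x u v q : F) (k : nat) :
    x != 0 -> 1 - x != 0 ->
  ((1 - x ^+ (1 + k)) - q * ((u + v * x) * (1 - x ^+ k))
     + q ^+ 2 * (u * v * (x - x ^+ k))) / (1 - x)
  = x ^+ k *
    (((1 - x^-1 ^+ (1 + k)) - q * ((v + u * x^-1) * (1 - x^-1 ^+ k))
     + q ^+ 2 * (u * v * (x^-1 - x^-1 ^+ k))) / (1 - x^-1)).
Proof.
move=> x0 x1; have y0 := expf_neq0 k x0.
(* With [y] for [x ^+ k], the claim is a rational identity in independent [x], [y], [u], [v],
   [q]. *)
rewrite !exprD !expr1 !exprVn; set y := x ^+ k in y0 *.
by field; rewrite x0 y0 x1 subr_eq0 eq_sym -subr_eq0 x1.
Qed.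

Theorem theorem6p4 (R : realType) (h : nat) (alpha beta gamma delta s : R[i])
    (h_gt0 : (0 < h)%N)
    (defL : C_defined alpha beta gamma delta h (- s))
    (defR : C_defined (- delta) (- gamma) (- beta) (- alpha) h s) :
  natpow h (- s + alpha) * C alpha beta gamma delta h (- s) =
  natpow h (s - delta) * C (- delta) (- gamma) (- beta) (- alpha) h s.
Proof.
rewrite !natpow_primes// /C -!big_split /=.
apply: eq_big_seq => p; rewrite mem_primes => /and3P[pp _ ph].
have [_ x1] := defL p pp ph.
(* The inverse powers of [p] take the form [q], [q ^+ 2] with [q] the inverse of [p]. *)
rewrite /C0 /C1 /C2 /Cx -!exprVn.
(* The exponent in the first product of [C] is fixed by the substitution; the next one, that of [x],
   changes sign. *)
have -> : - 2 - delta - - gamma + - beta - - alpha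
        = - 2 + alpha - beta + gamma - delta by ring.
have -> : - - delta - - alpha - 2 * s = - (- alpha - delta - 2 * - s) by ring.
have -> : - beta - - alpha = alpha - beta by ring.
have -> : - delta - - gamma = gamma - delta by ring.
have -> : gamma - delta - beta - - alpha = (gamma - delta) + (alpha - beta) by ring.
have -> : alpha - beta + gamma - delta = (gamma - delta) + (alpha - beta) by ring.
(* The second summand is the exponent of [x], so the right-hand power of [h] supplies the [x ^+ k]
   of [C_local_factor_invert]. *)
have -> : s - delta = (- s + alpha) + (- alpha - delta - 2 * - s) by ring.
rewrite natpowN (natpowD _ p (gamma - delta)) (natpowD _ p (- s + alpha)) exprMn.
rewrite C_local_factor_invert ?natpow_neq0//.
by ring.
Qed.
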